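(* Let $U$ and $A$ be monoids, and let $A\times U\to U$, $(\alpha,u)\mapsto\alpha\cdot u$, and $A\times U\to A$, $(\alpha,u)\mapsto\alpha^u$, be functions (defined on all of $A\times U$) satisfying, for all $\alpha,\beta\in A$ and $u,v\in U$, $$(\alpha\beta)\cdot u=\alpha\cdot(\beta\cdot u),\quad (\alpha\beta)^u=\alpha^{\beta\cdot u}\beta^u,\quad \alpha\cdot(uv)=(\alpha\cdot u)(\alpha^u\cdot v),\quad \alpha^{uv}=(\alpha^u)^v,$$ $$\alpha^{1}=\alpha,\quad 1\cdot u=u,\quad \alpha\cdot 1=1,\quad 1^u=1.$$ Put on $U\times A$ the monoid multiplication $(u,\alpha)(v,\beta)=(u(\alpha\cdot v),\ \alpha^v\beta)$. Suppose that the monoids $U$ and $A$ have (monoid) presentations $\langle X\mid R\rangle$ and $\langle Y\mid T\rangle$, respectively, with $X\cap Y=\emptyset$, that the function $(\alpha,u)\mapsto\alpha\cdot u$ takes $Y\times X$ into $X$, and that the function $(\alpha,u)\mapsto\alpha^u$ takes $Y\times X$ into $Y$. Then a monoid presentation for $U\times A$ is $$\langle X\cup Y\mid R\cup T\cup W\rangle$$ in which $W$ consists of all pairs $(\alpha u,\ (\alpha\cdot u)(\alpha^u))$ for $(\alpha,u)\in Y\times X$. (The generator $x\in X$ corresponds to $(x,1)$ and $y\in Y$ to $(1,y)$.)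
   Context: A monoid presentation $\langle X\mid R\rangle$ consists of a set $X$ and a binary relation $R$ on the free monoid $X^*$ of words in $X$; it presents the quotient of $X^*$ by the congruence generated by $R$. Elements of $X$ and $Y$ are identified with the elements of $U$ and $A$ they represent, so each pair in $W$ is a pair of two-letter words in the alphabet $X\cup Y$. *)

(* Defs.v *)
From HB Require Import structures.
From mathcomp Require Import all_boot.
From mathcomp Require Import boolp.

Set Implicit Arguments.
Unset Strict Implicit.
Unset Printing Implicit Defensive.

Local Open Scope group_scope.
Local Open Scope quotient_scope.

(* The free monoid on a set.  Equality and choice on words are obtained from
   the classical axioms, so the alphabet is an arbitrary type. *)
Definition word (X : Type) : Type := seq X.

HB.instance Definition _ (X : Type) := gen_eqMixin (word X).
HB.instance Definition _ (X : Type) := gen_choiceMixin (word X).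
HB.instance Definition _ (X : Type) :=
  isMonoid.Build (word X) (@catA X) (@cat0s X) (@cats0 X).

(* The congruence on the free monoid generated by a binary relation. *)
Inductive gen_cong (X : Type) (R : word X -> word X -> Prop) :
    word X -> word X -> Prop :=
  | GenCongBase u v : R u v -> gen_cong R u v
  | GenCongRefl u : gen_cong R u u
  | GenCongSym u v : gen_cong R u v -> gen_cong R v u
  | GenCongTrans u v w : gen_cong R u v -> gen_cong R v w -> gen_cong R u w
  | GenCongMul u u' v v' :
      gen_cong R u u' -> gen_cong R v v' -> gen_cong R (u * v) (u' * v').

Definition gen_congb (X : Type) (R : word X -> word X -> Prop) : rel (word X) :=
  fun u v => `[< gen_cong R u v >].

Section PresentedMonoid.
Variables (X : Type) (R : word X -> word X -> Prop).

Lemma gen_congb_refl : reflexive (gen_congb R).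
Proof. by move=> u; apply/asboolP; exact: GenCongRefl. Qed.

Lemma gen_congb_sym : symmetric (gen_congb R).
Proof. by move=> u v; apply/asboolP/asboolP; exact: GenCongSym. Qed.

Lemma gen_congb_trans : transitive (gen_congb R).
Proof.
by move=> v u w /asboolP uv /asboolP vw; apply/asboolP; exact: GenCongTrans uv vw.
Qed.

Canonical gen_congb_equiv_rel :=
  EquivRel (gen_congb R) gen_congb_refl gen_congb_sym gen_congb_trans.

Definition presented_monoid : Type := {eq_quot (gen_congb R)}.

HB.instance Definition _ := Choice.on presented_monoid.
HB.instance Definition _ := EqQuotient.on presented_monoid.

Definition presented_pi (u : word X) : presented_monoid :=
  \pi_({eq_quot (gen_congb R)}) u.

Lemma eq_presentedP (u v : word X) :
  presented_pi u = presented_pi v <-> gen_cong R u v.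
Proof. by split=> [/eqmodP /asboolP|uv]; [|apply/eqmodP/asboolP]. Qed.

Lemma presented_piP (P : presented_monoid -> Prop) :
  (forall u, P (presented_pi u)) -> forall a, P a.
Proof. exact: quotW. Qed.

Definition presented_one : presented_monoid := presented_pi 1.
Definition presented_mul (a b : presented_monoid) : presented_monoid :=
  presented_pi ((repr a : word X) * (repr b : word X)).

Lemma presented_mul_pi (u v : word X) :
  presented_mul (presented_pi u) (presented_pi v) = presented_pi (u * v).
Proof.
by apply/eq_presentedP/GenCongMul; apply/eq_presentedP; exact: reprK.
Qed.

Lemma presented_mulA : associative presented_mul.
Proof.
elim/presented_piP=> u; elim/presented_piP=> v; elim/presented_piP=> w.
by rewrite (presented_mul_pi v w) (presented_mul_pi u v) !presented_mul_pi mulgA.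
Qed.

Lemma presented_mul1 : left_id presented_one presented_mul.
Proof. by elim/presented_piP=> u; rewrite presented_mul_pi mul1g. Qed.

Lemma presented_mulr1 : right_id presented_one presented_mul.
Proof. by elim/presented_piP=> u; rewrite presented_mul_pi mulg1. Qed.

HB.instance Definition _ := isMonoid.Build presented_monoid
  presented_mulA presented_mul1 presented_mulr1.

Definition presented_gen (x : X) : presented_monoid := presented_pi [:: x].

End PresentedMonoid.

(* <X | R> is a presentation of M in which the generator x represents i x. *)
Definition is_presentation (M : monoidType) (X : Type) (i : X -> M)
    (R : word X -> word X -> Prop) : Prop :=
  exists phi : UMagmaMorphism.type (presented_monoid R) M,
    bijective phi /\ forall x, phi (presented_gen R x) = i x.

(* act alpha u is $\alpha\cdot u$ and res alpha u is $\alpha^u$. *)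
Record zappa_szep_axioms (U A : monoidType)
    (act : A -> U -> U) (res : A -> U -> A) : Prop := ZappaSzepAxioms {
  zs_actM : forall a b u, act (a * b) u = act a (act b u);
  zs_resM : forall a b u, res (a * b) u = res a (act b u) * res b u;
  zs_act_mul : forall a u v, act a (u * v) = act a u * act (res a u) v;
  zs_res_mul : forall a u v, res a (u * v) = res (res a u) v;
  zs_res1 : forall a, res a 1 = a;
  zs_act1 : forall u, act 1 u = u;
  zs_act_one : forall a, act a 1 = 1;
  zs_res_one : forall u, res 1 u = 1
}.

Section ZappaSzepProduct.
Variables (U A : monoidType) (act : A -> U -> U) (res : A -> U -> A).
Variable (H : zappa_szep_axioms act res).

(* An alias of U * A, since MathComp equips U * A with the direct product. *)
Definition zs_prod of zappa_szep_axioms act res : Type := (U * A)%type.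

HB.instance Definition _ := Choice.copy (zs_prod H) (U * A)%type.

Definition zs_one : zs_prod H := (1, 1).
Definition zs_mul (p q : zs_prod H) : zs_prod H :=
  (p.1 * act p.2 q.1, res p.2 q.1 * q.2).

Lemma zs_mulA : associative zs_mul.
Proof.
move=> [u a] [v b] [w c]; rewrite /zs_mul /= (zs_act_mul H) (zs_resM H).
by rewrite (zs_actM H) (zs_res_mul H) !mulgA.
Qed.

Lemma zs_mul1 : left_id zs_one zs_mul.
Proof. by move=> [u a]; rewrite /zs_mul /= (zs_act1 H) (zs_res_one H) !mul1g. Qed.

Lemma zs_mulr1 : right_id zs_one zs_mul.
Proof. by move=> [u a]; rewrite /zs_mul /= (zs_act_one H) (zs_res1 H) !mulg1. Qed.

HB.instance Definition _ :=
  isMonoid.Build (zs_prod H) zs_mulA zs_mul1 zs_mulr1.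

End ZappaSzepProduct.

(* The relations R, T and W on the disjoint union of the alphabets.  In W,
   x' and y' are the letters representing $y\cdot x$ and $y^x$. *)
Inductive zs_rel (U A : monoidType) (act : A -> U -> U) (res : A -> U -> A)
    (X Y : Type) (iX : X -> U) (iY : Y -> A)
    (R : word X -> word X -> Prop) (T : word Y -> word Y -> Prop) :
    word (X + Y) -> word (X + Y) -> Prop :=
  | ZsRelR (u v : word X) : R u v ->
      zs_rel act res iX iY R T (map inl u) (map inl v)
  | ZsRelT (u v : word Y) : T u v ->
      zs_rel act res iX iY R T (map inr u) (map inr v)
  | ZsRelW (y : Y) (x : X) (x' : X) (y' : Y) :
      iX x' = act (iY y) (iX x) -> iY y' = res (iY y) (iX x) ->
      zs_rel act res iX iY R T [:: inr y; inl x] [:: inl x'; inr y'].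

Definition zs_gen (U A : monoidType) (act : A -> U -> U) (res : A -> U -> A)
    (H : zappa_szep_axioms act res) (X Y : Type) (iX : X -> U) (iY : Y -> A)
    (z : X + Y) : zs_prod H :=
  match z with inl x => (iX x, 1) | inr y => (1, iY y) end.

(* Main.v *)
Require Import Defs.
From HB Require Import structures.
From mathcomp Require Import all_boot.
From mathcomp Require Import boolp.

(* By the relations W every word over X + Y is congruent to a word over X
   followed by a word over Y.  Such a word represents the pair of the elements
   represented by its two parts, so two of them with the same value are
   congruent by R and T. *)

Set Implicit Arguments.
Unset Strict Implicit.
Unset Printing Implicit Defensive.

Local Open Scope group_scope.

(** The pullback of a congruence along the word morphism [map f] is again a congruence, so the
    generating pairs suffice. This carries congruences over X and over Y to X + Y. *)
Lemma gen_cong_map (X Z : Type) (f : X -> Z)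
    (R : word X -> word X -> Prop) (S : word Z -> word Z -> Prop) :
    (forall u v, R u v -> gen_cong S (map f u) (map f v)) ->
  forall u v, gen_cong R u v -> gen_cong S (map f u) (map f v).
Proof.
move=> RS u v; elim=> {u v} [u v /RS //|u|u v _|u v w _ uv _|u u' v v' _ uu' _ vv'].
- exact: GenCongRefl.
- exact: GenCongSym.
- exact: GenCongTrans.
- by rewrite !map_cat; exact: GenCongMul.
Qed.

Definition word_eval (M : monoidType) (X : Type) (i : X -> M) (w : word X) : M :=
  \big[*%g/1]_(x <- w) i x.

Section WordEval.
Variables (M : monoidType) (X : Type) (i : X -> M).

Lemma word_eval1 : word_eval i 1 = 1.
Proof. exact: big_nil. Qed.

Lemma word_evalM (u v : word X) :
  word_eval i (u * v) = word_eval i u * word_eval i v.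
Proof. exact: big_cat. Qed.

Lemma word_eval_cons x (w : word X) :
  word_eval i (x :: w) = i x * word_eval i w.
Proof. exact: big_cons. Qed.

(** The kernel of evaluation is itself a congruence. *)
Lemma word_eval_gen_cong (R : word X -> word X -> Prop) :
    (forall u v, R u v -> word_eval i u = word_eval i v) ->
  forall u v, gen_cong R u v -> word_eval i u = word_eval i v.
Proof.
move=> Ri u v; elim=> {u v} [u v /Ri //|//|//|u v w _ -> //|].
by move=> u u' v v' _ uu' _ vv'; rewrite !word_evalM uu' vv'.
Qed.

Lemma word_eval_morphism (R : word X -> word X -> Prop)
    (phi : UMagmaMorphism.type (presented_monoid R) M) :
    (forall x, phi (presented_gen R x) = i x) ->
  forall w, phi (presented_pi R w) = word_eval i w.
Proof.
move=> phi_gen; elim=> [|x w IHw].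
  by rewrite word_eval1; exact: gmulf1.
rewrite word_eval_cons -IHw -phi_gen -gmulfM; congr (phi _).
by rewrite -(presented_mul_pi R [:: x] w).
Qed.

Section EvalMorphism.
Variable R : word X -> word X -> Prop.
Hypothesis evalR : forall u v, gen_cong R u v -> word_eval i u = word_eval i v.

(* The proof is an argument so that the instances below can refer to it. *)
Definition presented_eval of
  (forall u v, gen_cong R u v -> word_eval i u = word_eval i v) :=
  fun a : presented_monoid R => word_eval i (repr a : word X).
Local Notation phi := (presented_eval evalR).

(** [repr] returns only some word congruent to [w]; [evalR] makes its choice irrelevant. *)
Lemma presented_eval_pi w : phi (presented_pi R w) = word_eval i w.
Proof. by apply/evalR/eq_presentedP; exact: reprK. Qed.

Lemma presented_evalM : {morph phi : a b / a * b}.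
Proof.
elim/presented_piP=> u; elim/presented_piP=> v.
rewrite -[_ * _]/(presented_mul _ _) presented_mul_pi.
by rewrite !presented_eval_pi word_evalM.
Qed.

Lemma presented_eval1 : phi 1 = 1.
Proof. by rewrite -[1]/(presented_pi R 1) presented_eval_pi word_eval1. Qed.

HB.instance Definition _ := isMultiplicative.Build _ _ phi presented_evalM.
HB.instance Definition _ :=
  Multiplicative_isUMagmaMorphism.Build _ _ phi presented_eval1.

End EvalMorphism.

(** Trades the quotient and its isomorphism for statements about words, the form in which
    presentations are used and established below. *)
Lemma is_presentationP (R : word X -> word X -> Prop) :
  is_presentation i R <->
    (forall m, exists w, word_eval i w = m) /\
    (forall u v, gen_cong R u v <-> word_eval i u = word_eval i v).
Proof.
split=> [[phi [phi_bij /word_eval_morphism phi_pi]]|[eval_surj evalP]].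
  have [psi phiK psiK] := phi_bij; split=> [m|u v].
    by rewrite -[m]psiK; elim/presented_piP: (psi m) => w; exists w.
  by rewrite -!phi_pi -eq_presentedP; split=> [-> //|/(bij_inj phi_bij)].
have evalR u v := (evalP u v).1.
exists (presented_eval evalR); split=> [|x]; last first.
  by rewrite -[RHS](big_seq1 *%g); exact: presented_eval_pi.
(* The inverse chooses some word with value [m]; by [evalP] all such words are congruent. *)
exists (fun m => presented_pi R (projT1 (cid (eval_surj m)))) => [|m].
  elim/presented_piP=> w; apply/eq_presentedP/evalP.
  by case: cid => w' /= ->; exact: presented_eval_pi.
by case: cid => w /= <-; exact: presented_eval_pi.
Qed.

End WordEval.

Section ZappaSzep.
Variables (U A : monoidType) (act : A -> U -> U) (res : A -> U -> A).
Variables (X Y : Type) (iX : X -> U) (iY : Y -> A).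
Variables (R : word X -> word X -> Prop) (T : word Y -> word Y -> Prop).

Local Notation W := (zs_rel act res iX iY R T).

Section Evaluation.
Variable H : zappa_szep_axioms act res.
Local Notation gen := (zs_gen H iX iY).

(** The casts select the twisted multiplication instead of the componentwise one on [U * A]. *)
Lemma zs_mulE (u v : U) (a b : A) :
  ((u, a) : zs_prod H) * ((v, b) : zs_prod H) =
  ((u * act a v, res a v * b) : zs_prod H).
Proof. by []. Qed.

Lemma zs_eval_inl (p : word X) :
  word_eval gen (map inl p) = (word_eval iX p, 1).
Proof.
elim: p => [|x p IHp] /=; first by rewrite !word_eval1.
by rewrite !word_eval_cons IHp zs_mulE (zs_act1 H) (zs_res_one H) mulg1.
Qed.

Lemma zs_eval_inr (q : word Y) :
  word_eval gen (map inr q) = (1, word_eval iY q).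
Proof.
elim: q => [|y q IHq] /=; first by rewrite !word_eval1.
by rewrite !word_eval_cons IHq zs_mulE (zs_act_one H) (zs_res1 H) mul1g.
Qed.

Lemma zs_eval_normal (p : word X) (q : word Y) :
  word_eval gen (map inl p ++ map inr q) =
  (word_eval iX p, word_eval iY q).
Proof.
rewrite word_evalM zs_eval_inl zs_eval_inr zs_mulE.
by rewrite (zs_act1 H) (zs_res1 H) mulg1 mul1g.
Qed.

(** For a pair in W, both (1, y)(x, 1) and (y·x, 1)(1, y^x) equal (y·x, y^x). *)
Lemma zs_rel_eval :
    (forall u v, R u v -> word_eval iX u = word_eval iX v) ->
    (forall u v, T u v -> word_eval iY u = word_eval iY v) ->
  forall u v, W u v -> word_eval gen u = word_eval gen v.
Proof.
move=> evalR evalT _ _ [u v /evalR uv|u v /evalT uv|y x x' y' ex' ey'].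
- by rewrite !zs_eval_inl uv.
- by rewrite !zs_eval_inr uv.
rewrite /word_eval !big_cons !big_nil !mulg1 /= !zs_mulE ex' ey'.
by rewrite (zs_act1 H) (zs_res1 H) !mul1g !mulg1.
Qed.

End Evaluation.

Hypothesis actYX : forall y x, exists x', act (iY y) (iX x) = iX x'.
Hypothesis resYX : forall y x, exists y', res (iY y) (iX x) = iY y'.

(** Crossing x turns y into y^x, still a single letter by [resYX]; hence the induction on [p] is
    uniform in [y]. *)
Lemma zs_move_letter (y : Y) (p : word X) : exists (p' : word X) (y' : Y),
  gen_cong W (inr y :: map inl p) (map inl p' ++ [:: inr y']).
Proof.
elim: p y => [|x p IHp] y /=; first by exists [::], y; exact: GenCongRefl.
have [[x' ex'] [y1 ey1]] := (actYX y x, resYX y x).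
have [p' [y' IH]] := IHp y1; exists (x' :: p'), y'.
(* W rewrites the first two letters; then [y1] crosses the rest by induction. *)
apply: (@GenCongTrans _ _ _ (inl x' :: inr y1 :: map inl p)).
  apply: (@GenCongMul _ _ [:: inr y; inl x] [:: inl x'; inr y1]).
    by apply/GenCongBase/ZsRelW.
  exact: GenCongRefl.
by apply: (@GenCongMul _ _ [:: inl x'] [:: inl x']) => //; exact: GenCongRefl.
Qed.

(** Going through [w] from its right end, a letter of X joins [p] directly, while a letter of Y
    first crosses [p] and then joins [q]. *)
Lemma zs_normal_form (w : word (X + Y)) : exists (p : word X) (q : word Y),
  gen_cong W w (map inl p ++ map inr q).
Proof.
elim: w => [|z w [p [q IHw]]]; first by exists [::], [::]; exact: GenCongRefl.
have zw : gen_cong W (z :: w) (z :: map inl p ++ map inr q).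
  by apply: (@GenCongMul _ _ [:: z] [:: z]) => //; exact: GenCongRefl.
case: z zw => [x|y] zw; first by exists (x :: p), q.
have [p' [y' py]] := zs_move_letter y p; exists p', (y' :: q).
apply: GenCongTrans zw _.
(* Regroups [y'] with the first block, so that [py] applies with [map inr q] unchanged on the
   right. *)
rewrite /= -cat_cons -cat_rcons -cats1.
exact: GenCongMul py (GenCongRefl _ _).
Qed.

End ZappaSzep.

Theorem lemma3p17 (U A : monoidType)
    (act : A -> U -> U) (res : A -> U -> A) (H : zappa_szep_axioms act res)
    (X Y : Type) (iX : X -> U) (iY : Y -> A)
    (R : word X -> word X -> Prop) (T : word Y -> word Y -> Prop)
    (presU : is_presentation iX R) (presA : is_presentation iY T)
    (actYX : forall (y : Y) (x : X), exists x' : X, act (iY y) (iX x) = iX x')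
    (resYX : forall (y : Y) (x : X), exists y' : Y, res (iY y) (iX x) = iY y') :
  is_presentation (zs_gen H iX iY) (zs_rel act res iX iY R T).
Proof.
move/is_presentationP: presU => [surjU evalU].
move/is_presentationP: presA => [surjA evalA].
set W := zs_rel _ _ _ _ _ _; set gen := zs_gen H iX iY.
have evalW u v : gen_cong W u v -> word_eval gen u = word_eval gen v.
  move: u v; apply: word_eval_gen_cong; apply: zs_rel_eval => u v uv.
    exact/evalU/GenCongBase.
  exact/evalA/GenCongBase.
apply/is_presentationP; split=> [[u a]|w w'].
  have [[p <-] [q <-]] := (surjU u, surjA a).
  by exists (map inl p ++ map inr q); exact: zs_eval_normal.
split=> [/evalW //|ww'].
have [p [q wE]] := zs_normal_form R T actYX resYX w.
have [p' [q' wE']] := zs_normal_form R T actYX resYX w'.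
apply: (GenCongTrans wE (GenCongTrans _ (GenCongSym wE'))).
(* The normal forms have equal values too, and these are pairs: their components compare [p] with
   [p'] in U and [q] with [q'] in A separately. *)
move: ww'; rewrite (evalW _ _ wE) (evalW _ _ wE') !zs_eval_normal.
case=> /evalU pp' /evalA qq'; apply: GenCongMul.
  by apply: gen_cong_map pp' => u v uv; apply/GenCongBase/ZsRelR.
by apply: gen_cong_map qq' => u v uv; apply/GenCongBase/ZsRelT.
Qed.
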